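(* Let $\lambda_1,\dots,\lambda_N\in(0,1)$, let $p=(p_1,\dots,p_N)$ be a probability vector with $p_i>0$ for all $i$, let $\alpha>0$, and let $\ell:\mathbb N\to\mathbb N$ be monotone increasing with $\liminf_{n\to\infty}\ell(n)/\log n=1/\alpha$. Put $m(n)=\lfloor\#\ell^{-1}(n)/n\rfloor$ and, for $s\ge0$, $$L(s)=\limsup_{n\to\infty}\frac1n\log\sum_{|\mathbf j|=n}\lambda_{\mathbf j}^{s}\big(1-(1-p_{\mathbf j})^{m(n)}\big).$$ Let $s(\alpha)$ be the unique solution of $L(s(\alpha))=0$. Then $$\inf_{q\in[0,1]}P_\alpha(q)=s(\alpha),$$ where $P_\alpha(q)$ denotes the unique real solution of $\sum_{i=1}^N\lambda_i^{P_\alpha(q)}(p_ie^\alpha)^q=1$.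
   Context: The sum runs over words $\mathbf j=(j_1,\dots,j_n)\in\{1,\dots,N\}^n$, with $\lambda_{\mathbf j}=\lambda_{j_1}\cdots\lambda_{j_n}$ and $p_{\mathbf j}=p_{j_1}\cdots p_{j_n}$; $\log 0=-\infty$. The function $L$ (the ''probabilistic pressure'') is continuous and strictly decreasing on $[0,\infty)$, with $L(0)\ge0$ and $L(s)\to-\infty$ as $s\to\infty$, so it has a unique zero. *)

(* Defs.v *)
From HB Require Import structures.
From mathcomp Require Import all_boot all_order all_algebra finmap.
From mathcomp Require Import all_classical all_reals all_analysis.

Set Implicit Arguments.
Unset Strict Implicit.
Unset Printing Implicit Defensive.

Import Order.TTheory GRing.Theory Num.Theory.
Import numFieldNormedType.Exports.

Local Open Scope classical_set_scope.
Local Open Scope ring_scope.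

(* The letters 1, ..., N are represented by 'I_N, words of length n by
   {ffun 'I_n -> 'I_N}. *)
Definition word_prod (R : realType) (N n : nat) (a : 'I_N -> R)
  (j : {ffun 'I_n -> 'I_N}) : R := \prod_(k < n) a (j k).

(* floor (#ell^{-1}(n) / n). When ell tends to infinity all fibres are finite,
   so the value of fset_set on infinite sets is irrelevant; so is the value at
   n = 0, which does not affect limits superior. *)
Definition fibre_mult (ell : nat -> nat) (n : nat) : nat :=
  (#|` fset_set (ell @^-1` [set n])| %/ n)%N.

Definition pressure_sum (R : realType) (N : nat) (lam p : 'I_N -> R)
  (ell : nat -> nat) (s : R) (n : nat) : R :=
  \sum_(j : {ffun 'I_n -> 'I_N})
    word_prod lam j `^ s * (1 - (1 - word_prod p j) ^+ fibre_mult ell n).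

(* lne is the extended logarithm: lne 0 = -oo. *)
Definition pressure (R : realType) (N : nat) (lam p : 'I_N -> R)
  (ell : nat -> nat) (s : R) : \bar R :=
  limn_esup (fun n : nat =>
    ((n%:R^-1 : R)%:E * lne (pressure_sum lam p ell s n)%:E)%E).

Definition pressure_zero (R : realType) (N : nat) (lam p : 'I_N -> R)
  (ell : nat -> nat) : set R :=
  [set s | 0 <= s /\ pressure lam p ell s = 0%E].

Definition s_crit (R : realType) (N : nat) (lam p : 'I_N -> R)
  (ell : nat -> nat) : R := xget 0 (pressure_zero lam p ell).

Definition P_root (R : realType) (N : nat) (lam p : 'I_N -> R)
  (alpha q : R) : set R :=
  [set t | \sum_(i < N) lam i `^ t * (p i * expR alpha) `^ q = 1].

Definition P_alpha (R : realType) (N : nat) (lam p : 'I_N -> R)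
  (alpha q : R) : R := xget 0 (P_root lam p alpha q).

(* Main.v *)
Require Import Defs.
From HB Require Import structures.
From mathcomp Require Import all_boot all_order all_algebra finmap ring lra.
From mathcomp Require Import all_classical all_reals all_analysis.

Set Implicit Arguments.
Unset Strict Implicit.
Unset Printing Implicit Defensive.

Import Order.TTheory GRing.Theory Num.Theory.
Import numFieldNormedType.Exports.

Local Open Scope classical_set_scope.
Local Open Scope ring_scope.

(** Write Z(s, q) for the sum over i of lam_i ^ s * (p_i * exp alpha) ^ q, which
    is [scaled_sum]. The proof rests on the formula

      pressure(s) = min over q in [0, 1] of ln Z(s, q),

    established in [pressure_le] and [pressure_ge].

    The limit inferior of ell(n) / ln n says that the multiplicity m(n) of the
    fibres grows at exponential rate at most alpha, and at rate alpha along a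
    subsequence ([fibre_mult_le], [fibre_mult_ge]; the lower bound is a
    pigeonhole argument over the fibres below a given index). The factor
    1 - (1 - p_j) ^ m is, up to a factor 2, the minimum of 1 and m * p_j.

    For the upper bound, the minimum of 1 and x is at most x ^ q for q in
    [0, 1], and the resulting sum over words is an n-th power, hence
    ln Z(s, q). For the lower bound, take the minimiser q0 and tilt: give the
    letter i the weight lam_i ^ s * (p_i * exp alpha) ^ q0 / Z(s, q0). Let D be
    the mean of ln p_i + alpha under these weights. The first-order condition
    at the minimum over [0, 1] says that q0 * D <= min (0, D)
    ([tilted_mean_argmin]), so for a typical word j, where
    ln p_j + n * alpha is close to n * D, the truncated quantity
    min (1, p_j * exp (n * alpha)) is not exponentially smaller than its power
    with exponent q0. Typical words carry almost all of the tilted mass by a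
    Chernoff bound ([hit_sum_ge]).

    Finally Z decreases strictly in s, and Z(P_alpha(q), q) = 1. Hence the
    pressure vanishes at s exactly when s <= P_alpha(q) for all q with equality
    for some q, that is, when s is the minimum of P_alpha
    ([pressure_zero_min]); and the infimum of P_alpha is such a zero
    ([pressure_zero_exists]). *)

(** * Limits superior and inferior through eventual and frequent bounds *)

Lemma limn_esup_le_near (R : realType) (u : (\bar R)^nat) (x : \bar R) :
  (\forall n \near \oo, (u n <= x)%E) -> (limn_esup u <= x)%E.
Proof.
move=> ux; apply: (@le_trans _ _ (ereal_sup (u @` [set n | (u n <= x)%E]))).
  by apply: ereal_inf_lbound; exists [set n | (u n <= x)%E].
by apply: ge_ereal_sup => _ [n /= ? <-].
Qed.

Lemma limn_esup_ge_often (R : realType) (u : (\bar R)^nat) (x : \bar R) :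
  (forall n0, exists2 n, (n0 <= n)%N & (x <= u n)%E) -> (x <= limn_esup u)%E.
Proof.
move=> xu; apply: le_ereal_inf_tmp => _ [V [n0 _ n0V] <-].
have [n n0n xun] := xu n0.
apply: (le_trans xun); apply: ereal_sup_ubound; exists n => //.
exact: n0V.
Qed.

Lemma limn_einf_gt_near (R : realType) (u : (\bar R)^nat) (x : \bar R) :
  (x < limn_einf u)%E -> \forall n \near \oo, (x < u n)%E.
Proof.
rewrite /limn_einf lteNr => /ereal_inf_lt[_ [V Voo <-]] supV.
apply: filterS Voo => n Vn; rewrite -lteN2.
by apply: le_lt_trans supV; apply: ereal_sup_ubound; exists n.
Qed.

Lemma limn_einf_lt_often (R : realType) (u : (\bar R)^nat) (x : \bar R) :
  (limn_einf u < x)%E -> forall n0, exists2 n, (n0 <= n)%N & (u n < x)%E.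
Proof.
move=> ux n0; apply: contrapT => nex.
suff : (x <= limn_einf u)%E by rewrite leNgt ux.
rewrite /limn_einf leeNr; apply: limn_esup_le_near.
exists n0 => // n /= n0n; rewrite leeN2 leNgt; apply/negP => unx.
by apply: nex; exists n.
Qed.

(** * Growth of the fibres of ell *)

Section fibre_growth.
Variables (R : realType) (alpha : R) (ell : nat -> nat).
Hypothesis alpha_gt0 : 0 < alpha.
Hypothesis ell_mono : {homo ell : a b / (a <= b)%N}.
Hypothesis ell_liminf :
  limn_einf (fun n : nat => ((ell n)%:R / ln (n%:R : R))%:E) = (alpha^-1)%:E.

Lemma ln_natr_gt0 k : (1 < k)%N -> 0 < ln (k%:R : R).
Proof. by move=> k1; rewrite ln_gt0// ltr1n. Qed.

Lemma ln_le_ell b : alpha < b ->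
  \forall k \near \oo, ln (k%:R : R) <= b * (ell k)%:R.
Proof.
move=> ab; have b0 : 0 < b by exact: lt_trans ab.
have : (b^-1%:E < limn_einf (fun n : nat => ((ell n)%:R / ln (n%:R : R))%:E))%E.
  by rewrite ell_liminf lte_fin ltf_pV2 ?posrE.
move=> /limn_einf_gt_near; apply: filterS2 (nbhs_infty_ge 2) => k /= k2.
by rewrite lte_fin ltr_pdivlMr ?ln_natr_gt0// mulrC ltr_pdivrMr// mulrC => /ltW.
Qed.

Lemma ell_le_ln b : 0 < b < alpha ->
  forall k0, exists2 k, (k0 <= k)%N & b * (ell k)%:R <= ln (k%:R : R).
Proof.
move=> /andP[b0 ba] k0.
have : (limn_einf (fun n : nat => ((ell n)%:R / ln (n%:R : R))%:E) < b^-1%:E)%E.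
  by rewrite ell_liminf lte_fin ltf_pV2 ?posrE.
move=> /limn_einf_lt_often/(_ (maxn k0 2))[k]; rewrite geq_max => /andP[k0k k2].
rewrite lte_fin ltr_pdivrMr ?ln_natr_gt0// mulrC ltr_pdivlMr// mulrC => /ltW h.
by exists k.
Qed.

Lemma near_ell_ge n : \forall k \near \oo, (n <= ell k)%N.
Proof.
have a2 : alpha < 2 * alpha by have := alpha_gt0; lra.
have h := @nbhs_infty_ger R (expR (2 * alpha * n%:R)).
have := ln_le_ell a2; apply: filterS2 h => k kn lnk.
have a0 : 0 < 2 * alpha by have := alpha_gt0; lra.
rewrite -(ler_nat R) -(ler_pM2l a0).
apply: le_trans lnk; rewrite -ler_expR lnK//.
by rewrite posrE; apply: lt_le_trans kn; exact: expR_gt0.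
Qed.

Lemma finite_ell_fibre n : finite_set (ell @^-1` [set n]).
Proof.
have [k0 _ k0P] := near_ell_ge n.+1.
apply: sub_finite_set (finite_II k0) => k /= ekn.
by rewrite ltnNge; apply/negP => /k0P /=; rewrite ekn ltnn.
Qed.

(** If ell k = n with n large, then k <= exp (b n) by [ln_le_ell], so the
    fibre over n has at most 1 + exp (b n) elements; dividing by n >= 2
    absorbs the additional element. *)
Lemma fibre_mult_le b : alpha < b ->
  \forall n \near \oo, (fibre_mult ell n)%:R <= expR (b * n%:R) :> R.
Proof.
move=> ab; have b0 : 0 < b by exact: lt_trans ab.
have [k0 _ k0P] := ln_le_ell ab.
have h := @nbhs_infty_ger R (k0%:R / b).
apply: filterS2 (nbhs_infty_ge 2) h => n /= n2 nk0.
have E1 : 1 <= expR (b * n%:R) by rewrite -expR0 ler_expR mulr_ge0// ltW.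
have cardle : (#|` fset_set (ell @^-1` [set n])|
    <= (Num.truncn (expR (b * n%:R))).+1)%N.
  apply: geq_card_fset_set; apply: subset_card_le => k /= ekn.
  have k_le : k%:R <= expR (b * n%:R).
    have [kk0|k0k] := ltnP k k0.
      apply: le_trans (_ : k0%:R <= _); first by rewrite ler_nat ltnW.
      apply: le_trans (expR_ge1Dx _); rewrite -lerBlDl.
      by rewrite lerBlDl ler_wpDl// mulrC -ler_pdivrMr.
    have [k1|k1] := leqP k 1; first by apply: le_trans E1; rewrite lern1.
    have := k0P k k0k; rewrite /= ekn -[leRHS]expRK ler_ln ?posrE ?expR_gt0//.
    by rewrite ltr0n ltnW.
  by rewrite ltnS truncn_ge_nat.
have {}cardle :
    (#|` fset_set (ell @^-1` [set n])|)%:R <= 2 * expR (b * n%:R) :> R.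
  apply: le_trans (_ : (Num.truncn (expR (b * n%:R))).+1%:R <= _).
    by rewrite ler_nat.
  rewrite -natr1; have := truncn_le (expR (b * n%:R)); rewrite expR_ge0; lra.
apply: le_trans (_ : 2^-1 * (#|` fset_set (ell @^-1` [set n])|)%:R <= _);
  last by lra.
rewrite ler_pdivlMl// -natrM ler_nat; apply: leq_trans (leq_divM _ n).
by rewrite mulnC leq_mul2l n2 orbT.
Qed.

(** The cubic term of the exponential series already dominates every multiple
    of the square. *)
Lemma expR_dominates_square (d c : R) : 0 < d ->
  \forall n \near \oo, c * n%:R ^+ 2 < expR (d * n%:R).
Proof.
move=> d0.
have h := @nbhs_infty_ger R (c * 6 / d ^+ 3).
near=> n; have n1 : 0 < n%:R :> R.
  by rewrite ltr0n; near: n; exact: nbhs_infty_gt.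
have dn0 : 0 <= d * n%:R by rewrite mulr_ge0// ltW.
apply: lt_le_trans (expR_ge1Dxn 2 dn0); rewrite ltr_pwDl//.
have -> : (2.+1)`!%:R = 6 :> R by [].
have h6 : c * 6 <= d ^+ 3 * n%:R.
  by rewrite mulrC (mulrC (d ^+ 3)) mulrC -ler_pdivrMr ?exprn_gt0//; near: n.
rewrite ler_pdivlMr// exprMn (exprS n%:R 2) mulrA [leLHS]mulrAC.
by rewrite ler_pM2r ?exprn_gt0.
Unshelve. all: by end_near. Qed.

(** By monotonicity, 0, ..., k all lie in the fibres over 0, ..., ell k. *)
Lemma ell_fibres_cover k :
  (k < \sum_(i < (ell k).+1) #|` fset_set (ell @^-1` [set val i])|)%N.
Proof.
rewrite (trivIset_sum_card (F := fun i => ell @^-1` [set i])); last first.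
- by move=> i j _ _ [x [/= <- <-]].
- exact: finite_ell_fibre.
apply: leq_card_fset_set.
  rewrite -(bigcup_mkord _ (fun i => ell @^-1` [set i])).
  by apply: bigcup_finite => // i _; exact: finite_ell_fibre.
apply: subset_card_le.
rewrite -(bigcup_mkord _ (fun i => ell @^-1` [set i])) => i /= ik.
by exists (ell i) => //=; rewrite ltnS; apply: ell_mono; rewrite -ltnS.
Qed.

(** Otherwise every fibre beyond some n0 has O(i exp (b i)) elements, so that
    k = O(n^2 exp (b n)) with n = ell k, by [ell_fibres_cover]. But the limit
    inferior yields arbitrarily large k with k >= exp (beta n), where beta is
    the midpoint of b and alpha. *)
Lemma fibre_mult_ge b : 0 < b < alpha ->
  forall n0, exists2 n, (n0 <= n)%N &
    expR (b * n%:R) <= (fibre_mult ell n)%:R :> R.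
Proof.
move=> /andP[b0 ba] n0; apply: contrapT => nex.
pose c i := #|` fset_set (ell @^-1` [set i])|.
(* The index 0 is excluded because division by 0 makes fibre_mult vanish. *)
pose n1 := maxn n0 1.
have c_le (n i : nat) : (n1 <= i)%N -> (i <= n)%N ->
    (c i)%:R <= 2 * n%:R * expR (b * n%:R) :> R.
  rewrite geq_max => /andP[n0i i_gt0] le_in.
  have mi : (fibre_mult ell i)%:R <= expR (b * i%:R) :> R.
    by rewrite leNgt; apply/negP => /ltW h; apply: nex; exists i.
  have ebi : expR (b * i%:R) <= expR (b * n%:R) :> R.
    by rewrite ler_expR ler_pM2l// ler_nat.
  have e1 : 1 <= expR (b * n%:R) :> R by rewrite -expR0 ler_expR mulr_ge0// ltW.
  have : (c i)%:R <= ((fibre_mult ell i).+1 * i)%:R :> R.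
    by rewrite ler_nat ltnW// ltn_ceil.
  move=> /le_trans; apply; rewrite natrM.
  have -> : 2 * n%:R * expR (b * n%:R) = 2 * expR (b * n%:R) * n%:R :> R by ring.
  apply: ler_pM => //; last by rewrite ler_nat.
  by rewrite -natr1; lra.
pose C := (\sum_(0 <= i < n1) c i)%N.
have k_le (n k : nat) : (n1 <= n)%N -> ell k = n ->
    k%:R <= (C%:R + 4) * n%:R ^+ 2 * expR (b * n%:R) :> R.
  move=> n1n ekn; have n_ge1 : 1 <= n%:R :> R.
    by rewrite ler1n (leq_trans _ n1n)// leq_maxr.
  have e1 : 1 <= expR (b * n%:R) :> R.
    by rewrite -expR0 ler_expR mulr_ge0// ltW.
  have := ell_fibres_cover k; rewrite ekn -(big_mkord xpredT c) => /ltnW.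
  rewrite (big_cat_nat (n := n1)) ?leqW//= -/C -(ler_nat R) natrD natr_sum.
  move=> /le_trans; apply.
  have -> : (C%:R + 4) * n%:R ^+ 2 * expR (b * n%:R) =
     C%:R * (n%:R ^+ 2 * expR (b * n%:R))
     + n%:R *+ 2 * (2 * n%:R * expR (b * n%:R)) :> R.
    by rewrite -mulr_natl; ring.
  apply: lerD.
    by rewrite ler_peMr// mulr_ege1// exprn_ege1.
  apply: (@le_trans _ _ (\sum_(n1 <= i < n.+1) (2 * n%:R * expR (b * n%:R)))).
    by apply: ler_sum_nat => i /andP[n1i]; rewrite ltnS; exact: c_le.
  rewrite sumr_const_nat -[leLHS]mulr_natl ler_wpM2r ?mulr_ge0 ?expR_ge0//.
  rewrite -mulrnA ler_nat (leq_trans (leq_subr _ _))//.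
  by rewrite muln2 -addnn -addn1 leq_add2l -(ler_nat R).
pose beta := (b + alpha) / 2.
have beta_b : 0 < beta - b by rewrite /beta; lra.
have beta_a : 0 < beta < alpha by rewrite /beta; lra.
have [k0 _ k0P] := expR_dominates_square (C%:R + 4) beta_b.
have [k1 _ k1P] := near_ell_ge (maxn k0 n1).
have [k] := ell_le_ln beta_a (maxn k1 1).
rewrite geq_max => /andP[/k1P /=]; rewrite geq_max => /andP[k0e n1e] k_gt0.
apply/negP; rewrite -ltNge -ltr_expR lnK ?posrE ?ltr0n//.
apply: le_lt_trans (k_le _ _ n1e erefl) _.
have -> : beta * (ell k)%:R = (beta - b) * (ell k)%:R + b * (ell k)%:R by ring.
by rewrite expRD ltr_pM2r ?expR_gt0//; exact: k0P.
Qed.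

End fibre_growth.

(** * Exponential tilting *)

(** Since exp (- u) >= 1 - u, one has exp u <= 1 / (1 - u), and the latter is
    at most the quadratic polynomial below as soon as u <= 1/2. *)
Lemma expR_le_quad (R : realType) (u : R) : u <= 2^-1 ->
  expR u <= 1 + u + 2 * u ^+ 2.
Proof.
move=> u2; have u1 : 0 < 1 - u by lra.
rewrite -[expR u]invrK -expRN; apply: (@le_trans _ _ (1 - u)^-1).
  by rewrite lef_pV2 ?posrE ?expR_gt0//; exact: expR_ge1Dx.
rewrite -[leLHS]mul1r ler_pdivrMr//.
have : 0 <= u ^+ 2 * (1 - 2 * u) by rewrite mulr_ge0 ?sqr_ge0//; lra.
have -> : (1 + u + 2 * u ^+ 2) * (1 - u) = 1 + u ^+ 2 * (1 - 2 * u) by ring.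
by rewrite lerDl.
Qed.

Definition partition_fun (R : realType) (I : finType) (w l : I -> R) (q : R)
  : R :=
  \sum_i w i * expR (q * l i).

Section tilting.
Variables (R : realType) (I : finType) (w l : I -> R).
Hypothesis w_gt0 : forall i, 0 < w i.
Hypothesis I_gt0 : (0 < #|I|)%N.
Local Notation Z := (partition_fun w l).

(** The logarithmic derivative of the partition function: the mean of l under
    the Gibbs weights w i * exp (q * l i) / Z q. *)
Definition tilted_mean (q : R) : R := (\sum_i w i * expR (q * l i) * l i) / Z q.

Lemma partition_fun_gt0 q : 0 < Z q.
Proof.
have /card_gt0P[i0 _] := I_gt0.
rewrite /partition_fun (bigD1 i0)//= ltr_pwDl ?mulr_gt0 ?expR_gt0//.
by rewrite sumr_ge0// => i _; rewrite mulr_ge0 ?expR_ge0// ltW.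
Qed.

Lemma continuous_partition_fun : continuous Z.
Proof.
apply: continuous_big; first exact: add_continuous.
move=> i _ q; apply: cvgM; first exact: cvg_cst.
apply: (@cvg_comp _ _ _ ( *%R^~ (l i)) expR); last exact: continuous_expR.
by apply: cvgM; [exact: cvg_id|exact: cvg_cst].
Qed.

(** First-order control of the centred moment generating function of the Gibbs
    weights: centring kills the linear term of [expR_le_quad], and the
    quadratic term is at most eps * t for small t. It serves both for the
    first-order condition at a minimum and for the Chernoff bounds. *)
Lemma tilted_mgf_le q eps : 0 < eps ->
  exists2 t0, 0 < t0 & forall t, `|t| <= t0 ->
    \sum_i w i * expR (q * l i) * expR (t * (l i - tilted_mean q))
      <= Z q * expR (`|t| * eps).
Proof.
move=> eps0; pose D := tilted_mean q; pose v i := w i * expR (q * l i).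
have v0 i : 0 <= v i by rewrite mulr_ge0 ?expR_ge0// ltW.
have centered : \sum_i v i * (l i - D) = 0.
  under eq_bigr do rewrite mulrBr.
  rewrite sumrB -mulr_suml -/(partition_fun w l q) /D /tilted_mean.
  by rewrite mulrC divfK ?subrr// gt_eqF// partition_fun_gt0.
pose B := 1 + \sum_i `|l i - D|.
have B1 : 1 <= B by rewrite lerDl sumr_ge0.
have cB i : `|l i - D| <= B.
  rewrite /B (bigD1 i)//= addrCA lerDl addr_ge0// sumr_ge0//.
have B0 : 0 < B by lra.
have B20 : 0 < 2 * B ^+ 2 by rewrite mulr_gt0 ?exprn_gt0.
exists (Num.min 1 eps / (2 * B ^+ 2)) => [|t].
  by rewrite divr_gt0 ?lt_min ?ltr01.
rewrite ler_pdivlMr// le_min => /andP[t1 te].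
have tc2 i : (t * (l i - D)) ^+ 2 <= `|t| ^+ 2 * B ^+ 2.
  rewrite -real_normK ?num_real// normrM exprMn ler_wpM2l ?sqr_ge0//.
  by rewrite lerXn2r// nnegrE ltW.
have tc i : t * (l i - D) <= 2^-1.
  apply: (le_trans (ler_norm _)); rewrite normrM.
  apply: (@le_trans _ _ (`|t| * B)); first by rewrite ler_wpM2l.
  have : `|t| * B <= `|t| * B ^+ 2 by rewrite ler_wpM2l// ler_eXnr.
  by move: t1; rewrite mulrCA; lra.
have term i : v i * expR (t * (l i - D)) <=
    v i + t * (v i * (l i - D)) + v i * (2 * (`|t| ^+ 2 * B ^+ 2)).
  apply: (@le_trans _ _ (v i * (1 + t * (l i - D) + 2 * (`|t| ^+ 2 * B ^+ 2)))).
    apply: ler_wpM2l => //; apply: le_trans (expR_le_quad (tc i)) _.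
    by rewrite lerD2l ler_pM2l.
  by rewrite le_eqVlt; apply/orP; left; apply/eqP; ring.
apply: (@le_trans _ _ (Z q * (1 + `|t| * eps))); last first.
  by rewrite ler_wpM2l ?expR_ge1Dx// ltW// partition_fun_gt0.
apply: (le_trans (ler_sum _ (fun i _ => term i))).
rewrite 2!big_split/= -mulr_sumr centered mulr0 addr0 -mulr_suml -/(Z q).
rewrite mulrDr mulr1.
rewrite lerD2l ler_wpM2l ?(ltW (partition_fun_gt0 _))//.
rewrite expr2 -mulrA mulrCA ler_wpM2l//.
by move: te; rewrite mulrCA.
Qed.

(** The variational inequality at a minimum over [0, 1]: moving a little from
    q0 towards q1 multiplies Z by about exp (t * tilted_mean q0), and this
    factor cannot be smaller than 1. At q1 = 0 and q1 = 1 it bounds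
    q0 * tilted_mean q0 by 0 and by tilted_mean q0. *)
Lemma tilted_mean_argmin q0 : 0 <= q0 <= 1 ->
  (forall q, 0 <= q <= 1 -> Z q0 <= Z q) ->
  forall q1, 0 <= q1 <= 1 -> 0 <= (q1 - q0) * tilted_mean q0.
Proof.
move=> q0_01 q0_min q1 q1_01; set D := tilted_mean q0.
have [->|q10] := eqVneq q1 q0; first by rewrite subrr mul0r.
have d0 : 0 < `|q1 - q0| by rewrite normr_gt0 subr_eq0.
apply/ler_addgt0Pr => e e0.
have [t0 t00 t0P] := tilted_mgf_le q0 (divr_gt0 e0 d0).
pose tau := Num.min 1 (t0 / `|q1 - q0|).
have tau0 : 0 < tau by rewrite lt_min ltr01 divr_gt0.
have tau1 : tau <= 1 by rewrite ge_min lexx.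
have tauN : `|tau * (q1 - q0)| = tau * `|q1 - q0| by rewrite normrM gtr0_norm.
have /t0P : `|tau * (q1 - q0)| <= t0.
  by rewrite tauN -ler_pdivlMr// ge_min lexx orbT.
rewrite tauN -/D -mulrA (mulrCA _ e) divff ?gt_eqF// mulr1.
set t := tau * (q1 - q0); set s := \sum_i _ => sle.
have : 0 <= q0 + t <= 1.
  have : 0 <= (1 - tau) * q0 by rewrite mulr_ge0//; lra.
  have : 0 <= tau * q1 by rewrite mulr_ge0//; lra.
  have : 0 <= (1 - tau) * (1 - q0) by rewrite mulr_ge0//; lra.
  have : 0 <= tau * (1 - q1) by rewrite mulr_ge0//; lra.
  rewrite /t; lra.
move=> /q0_min; have -> : Z (q0 + t) = expR (t * D) * s.
  rewrite /partition_fun /s mulr_sumr; apply: eq_bigr => i _.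
  have -> : (q0 + t) * l i = t * D + (q0 * l i + t * (l i - D)) by ring.
  by rewrite !expRD; ring.
have h : expR (t * D) * s <= expR (t * D) * (Z q0 * expR (tau * e)).
  by rewrite ler_pM2l ?expR_gt0.
move=> /le_trans/(_ h); rewrite mulrCA -expRD -[leLHS]mulr1.
rewrite ler_pM2l ?partition_fun_gt0// -expR0 ler_expR /t -mulrA -mulrDr.
by rewrite pmulr_rge0.
Qed.
End tilting.

(** * Sums over words and hitting probabilities *)

Lemma sum_word_prod (R : realType) (N n : nat) (a : 'I_N -> R) :
  \sum_(j : {ffun 'I_n -> 'I_N}) word_prod a j = (\sum_i a i) ^+ n.
Proof.
rewrite /word_prod -(bigA_distr_bigA (fun (k : 'I_n) i => a i)).
by rewrite prodr_const card_ord.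
Qed.

Lemma word_prod_expR (R : realType) (N n : nat) (a : 'I_N -> R)
    (j : {ffun 'I_n -> 'I_N}) :
  word_prod (fun i => expR (a i)) j = expR (\sum_k a (j k)).
Proof. by rewrite /word_prod expR_sum. Qed.

Lemma word_prodM (R : realType) (N n : nat) (a b : 'I_N -> R)
    (j : {ffun 'I_n -> 'I_N}) :
  word_prod (fun i => a i * b i) j = word_prod a j * word_prod b j.
Proof. by rewrite /word_prod big_split. Qed.

Lemma word_prod_powR (R : realType) (N n : nat) (a : 'I_N -> R) (s : R)
    (j : {ffun 'I_n -> 'I_N}) : (forall i, 0 < a i) ->
  word_prod (fun i => a i `^ s) j = word_prod a j `^ s.
Proof.
move=> a0; have aE : a = fun i => expR (ln (a i)).
  by apply/funext => i; rewrite lnK// posrE.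
rewrite {2}aE word_prod_expR -expRM mulr_suml.
rewrite -(word_prod_expR (fun i => ln (a i) * s)).
by apply: eq_bigr => k _; rewrite expRM lnK// posrE.
Qed.

Lemma miss_prob_ge (R : realType) (p : R) (m : nat) : 0 <= p <= 1 ->
  1 - m%:R * p <= (1 - p) ^+ m.
Proof.
move=> /andP[p0 p1]; elim: m => [|m IH]; first by rewrite mul0r subr0 expr0.
rewrite exprS; apply: (@le_trans _ _ ((1 - p) * (1 - m%:R * p))); last first.
  by rewrite ler_wpM2l// subr_ge0.
rewrite -subr_ge0; have -> : (1 - p) * (1 - m%:R * p) - (1 - m.+1%:R * p)
   = m%:R * (p * p) by rewrite -natr1; ring.
by rewrite !mulr_ge0.
Qed.

(** The left-hand side is at most both 1 and exp (b + a), and the minimum of 1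
    and exp v is at most exp (q v) for q in [0, 1]. *)
Lemma hit_prob_le (R : realType) (a b q : R) (m : nat) :
  a <= 0 -> m%:R <= expR b -> 0 <= q <= 1 ->
  1 - (1 - expR a) ^+ m <= expR (q * (b + a)).
Proof.
move=> a0 mb /andP[q0 q1].
have pa1 : expR a <= 1 by rewrite -expR0 ler_expR.
have [ba0|ba0] := leP 0 (b + a).
  apply: (@le_trans _ _ 1).
    by rewrite gerBl exprn_ge0// subr_ge0.
  by rewrite -expR0 ler_expR mulr_ge0.
have := @miss_prob_ge _ (expR a) m; rewrite expR_ge0 pa1 => /(_ isT) hm.
apply: (@le_trans _ _ (expR (b + a))).
  rewrite expRD; apply: (@le_trans _ _ (m%:R * expR a)); first by lra.
  by rewrite ler_wpM2r ?expR_ge0.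
have : (1 - q) * (b + a) <= 0 by rewrite mulr_ge0_le0 ?subr_ge0 ?(ltW ba0).
by rewrite ler_expR; lra.
Qed.

(** With x = m exp a, the left-hand side is at most x / (1 + x), because
    (1 - exp a) ^ m <= exp (- x) <= 1 / (1 + x). *)
Lemma hit_prob_ge (R : realType) (a b : R) (m : nat) :
  a <= 0 -> expR b <= m%:R ->
  Num.min 1 (expR (b + a)) / 2 <= 1 - (1 - expR a) ^+ m.
Proof.
move=> a0 bm; set x := m%:R * expR a.
have x0 : 0 <= x by rewrite mulr_ge0// expR_ge0.
have pa1 : expR a <= 1 by rewrite -expR0 ler_expR.
have hx : (1 - expR a) ^+ m <= (1 + x)^-1.
  apply: (@le_trans _ _ (expR (- x))).
    rewrite /x -mulrN expRM_natl lerXn2r ?nnegrE ?subr_ge0 ?expR_ge0//.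
    exact: expR_ge1Dx.
  by rewrite expRN lef_pV2 ?posrE ?expR_gt0 ?expR_ge1Dx//; lra.
have min_x : Num.min 1 (expR (b + a)) <= Num.min 1 x.
  rewrite le_min ge_min lexx/= ge_min; apply/orP; right.
  by rewrite expRD ler_wpM2r ?expR_ge0.
apply: (@le_trans _ _ (1 - (1 + x)^-1)); last by rewrite lerD2l lerN2.
apply: (@le_trans _ _ (Num.min 1 x / 2)); first by rewrite ler_pM2r// invr_gt0.
have -> : 1 - (1 + x)^-1 = x / (1 + x) by field; lra.
rewrite ler_pdivlMr; last by lra.
case: (leP 1 x) => x1; first by lra.
have : x * x <= x by rewrite ler_piMr// ltW.
lra.
Qed.

(** The truncation at 1 costs only exp (- 2 r) with respect to exp (q (u + d))
    when the deviation u is at most r in absolute value, thanks to the two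
    conditions on q * d; when it is larger, the last factor on the left is
    negative. Writing the Chernoff bound inside a pointwise inequality makes
    it summable against product weights, by the product formula alone. *)
Lemma truncation_ge (R : realType) (q d u r t : R) :
  0 <= r -> 0 <= t -> 0 <= q <= 1 -> q * d <= 0 -> q * d <= d ->
  expR (q * (u + d)) * expR (- (2 * r)) *
    (1 - expR (- (t * r)) * (expR (t * u) + expR (- t * u)))
  <= Num.min 1 (expR (u + d)).
Proof.
move=> r0 t0 /andP[q0 q1] qd0 qdd.
have [ur|ur] := leP `|u| r.
  apply: (@le_trans _ _ (expR (q * (u + d)) * expR (- (2 * r)))).
    apply: ler_piMr; first by rewrite mulr_ge0 ?expR_ge0.
    by rewrite gerBl mulr_ge0 ?addr_ge0 ?expR_ge0.
  have qur : q * u <= r.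
    apply: le_trans (ler_norm _) _; rewrite normrM (ger0_norm q0).
    by apply: le_trans ur; rewrite ler_piMl.
  move: ur; rewrite ler_norml => /andP[ur1 ur2].
  rewrite -expRD le_min ler_expR mulrDr; apply/andP; split; last by lra.
  by rewrite -[leRHS]expR0 ler_expR; lra.
apply: (@le_trans _ _ 0); last by rewrite le_min ler01 expR_ge0.
rewrite mulr_ge0_le0 ?mulr_ge0 ?expR_ge0// subr_le0.
have h : expR (- (t * r)) * expR (t * `|u|) >= 1.
  by rewrite -expRD -expR0 ler_expR addrC subr_ge0 ler_wpM2l// ltW.
apply: (le_trans h); rewrite ler_pM2l ?expR_gt0//.
case: (ger0P u) => _; first by rewrite lerDl expR_ge0.
by rewrite mulrN -mulNr lerDr expR_ge0.
Qed.

(** * Upper and lower bounds of the hitting sums *)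

Definition hit_sum (R : realType) (N : nat) (w p : 'I_N -> R) (m n : nat)
  : R :=
  \sum_(j : {ffun 'I_n -> 'I_N})
    word_prod w j * (1 - (1 - word_prod p j) ^+ m).

Section hit_sum_bounds.
Variables (R : realType) (N : nat) (w p : 'I_N -> R).
Hypothesis w_gt0 : forall i, 0 < w i.
Hypothesis p_gt0 : forall i, 0 < p i.
Hypothesis p_le1 : forall i, p i <= 1.

Let logp n (j : {ffun 'I_n -> 'I_N}) : R := \sum_k ln (p (j k)).

Let word_probE n (j : {ffun 'I_n -> 'I_N}) : word_prod p j = expR (logp j).
Proof.
rewrite /logp -(word_prod_expR (fun i => ln (p i))).
by apply: eq_bigr => k _; rewrite lnK// posrE.
Qed.

Let logp_le0 n (j : {ffun 'I_n -> 'I_N}) : logp j <= 0.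
Proof. by apply: sumr_le0 => k _; rewrite ln_le0. Qed.

Let word_weight_ge0 n (j : {ffun 'I_n -> 'I_N}) : 0 <= word_prod w j.
Proof. by apply: prodr_ge0 => k _; rewrite ltW. Qed.

Let word_tiltE n (j : {ffun 'I_n -> 'I_N}) (f : 'I_N -> R) :
  word_prod w j * expR (\sum_k f (j k)) =
  word_prod (fun i => w i * expR (f i)) j.
Proof. by rewrite word_prodM word_prod_expR. Qed.

Lemma hit_sum_le (b q : R) (m n : nat) : 0 <= q <= 1 ->
  m%:R <= expR (b * n%:R) ->
  hit_sum w p m n <= partition_fun w (fun i => ln (p i) + b) q ^+ n.
Proof.
move=> q01 mb; rewrite /hit_sum /partition_fun -sum_word_prod.
apply: ler_sum => j _; rewrite -word_tiltE ler_wpM2l// word_probE.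
apply: (le_trans (hit_prob_le (logp_le0 j) mb q01)).
rewrite -mulr_sumr big_split/= sumr_const card_ord -[b *+ n]mulr_natr.
by rewrite [b * _ + _]addrC.
Qed.

Variable alpha : R.
Let l i := ln (p i) + alpha.
Local Notation Z := (partition_fun w l).

(** A Cramer-type lower bound. Under the Gibbs weights with parameter q0, the
    sum of l along a word of length n is n * D up to a deviation at most
    r = eps * n, outside an exponentially small set of words; D is the tilted
    mean, and q0 * D <= min (0, D) because q0 minimises Z. On the typical
    words, [truncation_ge] replaces the hitting probability by
    exp (q0 * (sum of l)), whose weighted sum is Z q0 ^ n. *)
Lemma hit_sum_ge (q0 eps : R) : (0 < N)%N -> 0 <= q0 <= 1 ->
  (forall q, 0 <= q <= 1 -> Z q0 <= Z q) -> 0 < eps ->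
  \forall n \near \oo, forall m, expR ((alpha - eps) * n%:R) <= m%:R ->
    Z q0 ^+ n * expR (- (4 * eps * n%:R)) <= hit_sum w p m n.
Proof.
move=> N0 q0_01 q0_min eps0.
have N0' : (0 < #|'I_N|)%N by rewrite card_ord.
have Z0 q : 0 < Z q by exact: partition_fun_gt0.
pose D := tilted_mean w l q0.
have Dge q1 : 0 <= q1 <= 1 -> 0 <= (q1 - q0) * D.
  exact: tilted_mean_argmin.
have qD0 : q0 * D <= 0 by have := Dge 0; rewrite lexx ler01 => /(_ isT); lra.
have qDD : q0 * D <= D by have := Dge 1; rewrite lexx ler01 => /(_ isT); lra.
have eps20 : 0 < eps / 2 by rewrite divr_gt0.
have [t t0 tP] := tilted_mgf_le l w_gt0 N0' q0 eps20.
have te0 : 0 < t * eps / 2 by rewrite divr_gt0// mulr_gt0.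
have := @expR_dominates_square _ (t * eps / 2) 4 te0.
have := @expR_dominates_square _ eps 4 eps0.
apply: filterS3 (nbhs_infty_ge 1) => n n1 en ten m bm.
have n2 : 1 <= n%:R ^+ 2 :> R by rewrite exprn_ege1// ler1n.
have {}en : 4 <= expR (eps * n%:R) by apply: le_trans (ltW en); lra.
have {}ten : 4 <= expR (t * eps / 2 * n%:R) by apply: le_trans (ltW ten); lra.
pose r := eps * n%:R; pose d := n%:R * D.
have r0 : 0 <= r by rewrite mulr_ge0// ltW.
pose u (j : {ffun 'I_n -> 'I_N}) := \sum_k (l (j k) - D).
have udE j : u j + d = \sum_k l (j k).
  rewrite /u big_split/= sumr_const card_ord /d mulNrn mulr_natl.
  by rewrite subrK.
have qd0 : q0 * d <= 0 by rewrite mulrCA mulr_ge0_le0.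
have qdd : q0 * d <= d by rewrite mulrCA ler_wpM2l.
pose g j := expR (q0 * (u j + d)) * expR (- (2 * r)) *
  (1 - expR (- (t * r)) * (expR (t * u j) + expR (- t * u j))).
have word_ge j : word_prod w j * (expR (- r) * g j / 2) <=
    word_prod w j * (1 - (1 - word_prod p j) ^+ m).
  rewrite ler_wpM2l// word_probE.
  apply: le_trans (hit_prob_ge (logp_le0 j) bm); rewrite ler_pM2r ?invr_gt0//.
  apply: (@le_trans _ _ (expR (- r) * Num.min 1 (expR (u j + d)))).
    by rewrite ler_wpM2l ?expR_ge0//; apply: truncation_ge => //; exact: ltW.
  have lE : (alpha - eps) * n%:R + logp j = u j + d - r.
    by rewrite udE big_split/= sumr_const card_ord -mulr_natr /r /logp; ring.
  rewrite lE le_min; apply/andP; split.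
    apply: (@le_trans _ _ (1 * 1)); last by rewrite mul1r.
    rewrite ler_pM ?expR_ge0 ?le_min ?ler01 ?expR_ge0// ?ge_min ?lexx//.
    by rewrite -expR0 ler_expR oppr_le0.
  by rewrite [leRHS]expRD mulrC ler_wpM2r ?expR_ge0// ge_min lexx orbT.
apply: le_trans (ler_sum _ (fun j _ => word_ge j)).
(* Z q0 ^ n times the tilted moment generating function of u at t' *)
pose A t' := \sum_(j : {ffun 'I_n -> 'I_N})
  word_prod w j * expR (q0 * (u j + d)) * expR (t' * u j).
have AE t' : A t' =
    (\sum_i w i * expR (q0 * l i) * expR (t' * (l i - D))) ^+ n.
  rewrite /A -sum_word_prod; apply: eq_bigr => j _.
  by rewrite !word_prodM !word_prod_expR udE /u !mulr_sumr.
have A0 : A 0 = Z q0 ^+ n.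
  rewrite AE; congr (_ ^+ n); apply: eq_bigr => i _.
  by rewrite mul0r expR0 mulr1.
have At t' : `|t'| = t -> A t' <= Z q0 ^+ n * expR (t * eps / 2 * n%:R).
  move=> t't; rewrite AE.
  apply: (@le_trans _ _ ((Z q0 * expR (t * (eps / 2))) ^+ n)).
    rewrite lerXn2r ?nnegrE ?mulr_ge0 ?expR_ge0 ?(ltW (Z0 _))//.
      by rewrite sumr_ge0// => i _; rewrite !mulr_ge0 ?expR_ge0// ltW.
    by have := tP t'; rewrite t't lexx => /(_ isT).
  by rewrite exprMn -expRM_natr mulrA.
have -> : \sum_(j : {ffun 'I_n -> 'I_N})
      word_prod w j * (expR (- r) * g j / 2) =
    expR (- r) * expR (- (2 * r)) / 2 *
      (A 0 - expR (- (t * r)) * (A t + A (- t))).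
  rewrite /A mulrBr -big_split/= !mulr_sumr -sumrB; apply: eq_bigr => j _.
  by rewrite /g mul0r expR0; ring.
have Zn0 : 0 < Z q0 ^+ n by rewrite exprn_gt0.
have bad : expR (- (t * r)) * (A t + A (- t)) <= Z q0 ^+ n / 2.
  have sumA : A t + A (- t) <= 2 * (Z q0 ^+ n * expR (t * eps / 2 * n%:R)).
    have h1 : A t <= _ := At t (gtr0_norm t0).
    have h2 : A (- t) <= _ := At (- t) (etrans (normrN _) (gtr0_norm t0)).
    lra.
  apply: (@le_trans _ _ (expR (- (t * r)) *
      (2 * (Z q0 ^+ n * expR (t * eps / 2 * n%:R))))).
    by rewrite ler_wpM2l ?expR_ge0.
  have -> : expR (- (t * r)) * (2 * (Z q0 ^+ n * expR (t * eps / 2 * n%:R))) =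
     Z q0 ^+ n * (2 * (expR (t * eps / 2 * n%:R))^-1).
    have -> : - (t * r) = - (t * eps / 2 * n%:R) - t * eps / 2 * n%:R.
      by rewrite /r; field.
    by rewrite expRD expRN; field; rewrite gt_eqF ?expR_gt0.
  rewrite ler_pM2l// -ler_pdivlMl// -invfM lef_pV2 ?posrE ?expR_gt0//; lra.
apply: (@le_trans _ _
    (expR (- r) * expR (- (2 * r)) / 2 * (Z q0 ^+ n / 2))); last first.
  rewrite ler_wpM2l ?divr_ge0 ?mulr_ge0 ?expR_ge0// A0; lra.
(* The factor 1/4 is absorbed by one more exp (- r). *)
have -> : - (4 * eps * n%:R) = - r + - (2 * r) + - r by rewrite /r; ring.
rewrite !expRD.
have er4 : expR (- r) <= 4^-1 by rewrite expRN lef_pV2 ?posrE ?expR_gt0.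
have -> : expR (- r) * expR (- (2 * r)) / 2 * (Z q0 ^+ n / 2) =
   Z q0 ^+ n * (expR (- r) * expR (- (2 * r)) * 4^-1) by field.
by rewrite ler_pM2l// ler_wpM2l ?mulr_ge0 ?expR_ge0.
Qed.

End hit_sum_bounds.

(** * The pressure as a minimum of logarithms of partition functions *)

Lemma scaled_lne_le (R : realType) (S x : R) (n : nat) : (0 < n)%N ->
  S <= expR (n%:R * x) -> ((n%:R^-1 : R)%:E * lne S%:E <= x%:E)%E.
Proof.
move=> n0 Sx; have n0R : 0 < n%:R :> R by rewrite ltr0n.
have [S0|S0] := ltP 0 S; last first.
  by rewrite le0_lneNy ?lee_fin// gt0_muleNy ?leNye// lte_fin invr_gt0.
rewrite lne_EFin// -EFinM lee_fin ler_pdivrMl//.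
by rewrite -ler_expR lnK ?posrE.
Qed.

Lemma scaled_lne_ge (R : realType) (S x : R) (n : nat) : (0 < n)%N ->
  expR (n%:R * x) <= S -> (x%:E <= (n%:R^-1 : R)%:E * lne S%:E)%E.
Proof.
move=> n0 Sx; have n0R : 0 < n%:R :> R by rewrite ltr0n.
have S0 : 0 < S by apply: lt_le_trans Sx; exact: expR_gt0.
rewrite lne_EFin// -EFinM lee_fin ler_pdivlMl//.
by rewrite -ler_expR lnK ?posrE.
Qed.

Section pressure_formula.
Variables (R : realType) (N : nat) (lam p : 'I_N -> R) (alpha : R).
Variable ell : nat -> nat.
Hypothesis lam01 : forall i, 0 < lam i < 1.
Hypothesis p_gt0 : forall i, 0 < p i.
Hypothesis p_sum1 : \sum_(i < N) p i = 1.
Hypothesis alpha_gt0 : 0 < alpha.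
Hypothesis ell_mono : {homo ell : a b / (a <= b)%N}.
Hypothesis ell_liminf :
  limn_einf (fun n : nat => ((ell n)%:R / ln (n%:R : R))%:E) = (alpha^-1)%:E.

Let lam_gt0 i : 0 < lam i. Proof. by case/andP: (lam01 i). Qed.

Let p_le1 i : p i <= 1.
Proof.
rewrite -p_sum1 (bigD1 i)//= lerDl sumr_ge0// => k _; exact: ltW.
Qed.

Let N_gt0 : (0 < N)%N.
Proof.
rewrite lt0n; apply/eqP => N0; move: p_sum1; rewrite big1 => [|i _].
  by move/esym/eqP; rewrite oner_eq0.
by exfalso; case: i => k; rewrite N0.
Qed.

Let has_letter : has predT (index_enum 'I_N).
Proof. by apply/hasP; exists (Ordinal N_gt0) => //; exact: mem_index_enum. Qed.

Definition scaled_sum (s q : R) : R :=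
  \sum_(i < N) lam i `^ s * (p i * expR alpha) `^ q.

Let mass_powE i q : (p i * expR alpha) `^ q = expR (q * (ln (p i) + alpha)).
Proof.
by rewrite mulrC [_ * (_ + _)]mulrC expRM addrC expRD lnK ?posrE.
Qed.

Let lam_powE i s : lam i `^ s = expR (s * ln (lam i)).
Proof. by rewrite mulrC expRM lnK ?posrE. Qed.

(** The same sum is a partition function in q and in s, so that both inherit
    continuity from [continuous_partition_fun]. *)
Lemma scaled_sum_qE s q :
  scaled_sum s q =
  partition_fun (fun i => lam i `^ s) (fun i => ln (p i) + alpha) q.
Proof. by apply: eq_bigr => i _; rewrite mass_powE. Qed.

Lemma scaled_sum_sE s q :
  scaled_sum s q =
  partition_fun (fun i => (p i * expR alpha) `^ q) (fun i => ln (lam i)) s.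
Proof. by apply: eq_bigr => i _; rewrite lam_powE mulrC. Qed.

Lemma scaled_sum_gt0 s q : 0 < scaled_sum s q.
Proof.
rewrite scaled_sum_qE partition_fun_gt0 ?card_ord// => i.
by rewrite powR_gt0.
Qed.

Lemma scaled_sum_decr q s s' : s < s' -> scaled_sum s' q < scaled_sum s q.
Proof.
move=> ss'; apply: ltr_sum; first exact: has_letter.
move=> i _; rewrite ltr_pM2r ?mass_powE ?expR_gt0// !lam_powE ltr_expR.
by rewrite ltr_nM2r// ln_lt0// lam01.
Qed.

(** Any common upper bound of the - ln (lam i) is suitable as a Lipschitz
    constant in s of the logarithm of [scaled_sum]. *)
Definition decay_rate : R := \sum_i - ln (lam i).

Lemma decay_rate_gt0 : 0 < decay_rate.
Proof.
have -> : 0 = \sum_(i < N) 0 :> R by rewrite big1.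
by apply: ltr_sum => [|i _]; [exact: has_letter|rewrite oppr_gt0 ln_lt0].
Qed.

Lemma scaled_sum_lipschitz q s s' : s <= s' ->
  scaled_sum s q <= expR ((s' - s) * decay_rate) * scaled_sum s' q.
Proof.
move=> ss'; rewrite mulr_sumr; apply: ler_sum => i _; rewrite mulrA.
rewrite ler_wpM2r ?powR_ge0// !lam_powE -expRD ler_expR.
have : - ln (lam i) <= decay_rate.
  rewrite /decay_rate (bigD1 i)//= lerDl sumr_ge0// => k _.
  by rewrite oppr_ge0 ln_le0// ltW//; case/andP: (lam01 k).
move=> /(ler_wpM2l (_ : 0 <= s' - s)); rewrite subr_ge0 => /(_ ss').
lra.
Qed.

Lemma scaled_sum0_ge1 q : 0 <= q <= 1 -> 1 <= scaled_sum 0 q.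
Proof.
move=> /andP[q0 q1]; rewrite -p_sum1; apply: ler_sum => i _.
rewrite powRr0 mul1r mass_powE -[leLHS]lnK ?posrE// ler_expR.
have lp0 : ln (p i) <= 0 by rewrite ln_le0.
have : 0 <= q * alpha by rewrite mulr_ge0// ltW.
have : (1 - q) * ln (p i) <= 0 by rewrite mulr_ge0_le0// subr_ge0.
lra.
Qed.

(** For t large, every summand is at most p i, and the p i sum up to 1. *)
Lemma scaled_sum_le1 q : 0 <= q <= 1 ->
  exists2 t, 0 <= t & scaled_sum t q <= 1.
Proof.
move=> /andP[q0 q1].
pose T i := (ln (p i) - q * (ln (p i) + alpha)) / ln (lam i).
exists (\sum_i `|T i|); first by rewrite sumr_ge0.
rewrite -p_sum1; apply: ler_sum => i _.
rewrite lam_powE mass_powE -expRD -[leRHS]lnK ?posrE// ler_expR.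
rewrite -lerBrDr -ler_ndivrMr ?ln_lt0//.
by rewrite (bigD1 i)//= (le_trans (ler_norm _))// lerDl sumr_ge0.
Qed.

Lemma P_root_exists_unique q : 0 <= q <= 1 ->
  exists! t, P_root lam p alpha q t.
Proof.
move=> q01; have [T T0 T1] := scaled_sum_le1 q01.
have g0 := scaled_sum0_ge1 q01.
have [||t _ tE] := @IVT R (scaled_sum^~ q) 0 T 1 T0.
- have -> : scaled_sum^~ q =
      partition_fun (fun i => (p i * expR alpha) `^ q) (fun i => ln (lam i)).
    by apply/funext => t; exact: scaled_sum_sE.
  exact/continuous_subspaceT/continuous_partition_fun.
- by rewrite ge_min T1 orbT le_max g0 .
exists t; split; first exact: tE.
move=> t' t'E; have [tt'|t't|//] := ltgtP t t'.
- by have := scaled_sum_decr q tt'; rewrite tE [scaled_sum t' q]t'E ltxx.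
- by have := scaled_sum_decr q t't; rewrite tE [scaled_sum t' q]t'E ltxx.
Qed.

Lemma P_alphaP q : 0 <= q <= 1 -> scaled_sum (P_alpha lam p alpha q) q = 1.
Proof.
move=> /P_root_exists_unique[t [tP _]].
exact: (xgetPex 0 (ex_intro _ t tP)).
Qed.

Lemma P_alpha_ge0 q : 0 <= q <= 1 -> 0 <= P_alpha lam p alpha q.
Proof.
move=> q01; rewrite leNgt; apply/negP => /(scaled_sum_decr q).
by rewrite P_alphaP// ltNge scaled_sum0_ge1.
Qed.

Let Phi s q := ln (scaled_sum s q).

Let pressure_sumE s n : pressure_sum lam p ell s n =
  hit_sum (fun i => lam i `^ s) p (fibre_mult ell n) n.
Proof. by apply: eq_bigr => j _; rewrite word_prod_powR. Qed.

Let lam_pow_gt0 s i : 0 < lam i `^ s. Proof. exact: powR_gt0. Qed.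

Lemma pressure_le s q : 0 <= q <= 1 ->
  (pressure lam p ell s <= (Phi s q)%:E)%E.
Proof.
move=> q01; apply/lee_addgt0Pr => e e0; apply: limn_esup_le_near.
have ae : alpha < alpha + e by rewrite ltrDl.
have := fibre_mult_le alpha_gt0 ell_liminf ae.
apply: filterS2 (nbhs_infty_ge 1) => n n1 mn.
rewrite -EFinD; apply: scaled_lne_le => //; rewrite pressure_sumE.
apply: (le_trans (hit_sum_le (lam_pow_gt0 s) p_gt0 p_le1 q01 mn)).
rewrite expRM_natl expRD lnK ?posrE ?scaled_sum_gt0//.
rewrite lerXn2r ?nnegrE ?mulr_ge0 ?expR_ge0 ?(ltW (scaled_sum_gt0 _ _))//.
  by rewrite sumr_ge0// => i _; rewrite mulr_ge0 ?expR_ge0 ?powR_ge0.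
rewrite scaled_sum_qE mulr_suml; apply: ler_sum => i _.
rewrite -mulrA ler_wpM2l ?powR_ge0// -expRD ler_expR.
have /andP[_ q1] := q01; have : q * e <= e by rewrite ler_piMl// ltW.
lra.
Qed.

(** The minimiser over q in [0, 1] is the one to which [hit_sum_ge] applies. *)
Lemma pressure_ge s : exists2 q, 0 <= q <= 1 &
  (forall q', 0 <= q' <= 1 -> scaled_sum s q <= scaled_sum s q') /\
  ((Phi s q)%:E <= pressure lam p ell s)%E.
Proof.
have [|q0 q0_01 q0_min] := @EVT_min R (scaled_sum s) 0 1 ler01.
  have -> : scaled_sum s =
      partition_fun (fun i => lam i `^ s) (fun i => ln (p i) + alpha).
    by apply/funext => q; exact: scaled_sum_qE.
  exact/continuous_subspaceT/continuous_partition_fun.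
rewrite in_itv/= in q0_01; exists q0 => //.
have {}q0_min q : 0 <= q <= 1 -> scaled_sum s q0 <= scaled_sum s q.
  by move=> q01; apply: q0_min; rewrite in_itv.
split => //; apply/lee_subgt0Pr => e e0.
apply: limn_esup_ge_often => n0.
pose eps := Num.min (e / 4) (alpha / 2).
have eps0 : 0 < eps by rewrite lt_min !divr_gt0.
have epsa : 0 < alpha - eps < alpha.
  have : eps <= alpha / 2 by rewrite ge_min lexx orbT.
  have := alpha_gt0; lra.
have epse : 4 * eps <= e by rewrite -ler_pdivlMl// mulrC ge_min lexx.
pose Z := partition_fun (fun i => lam i `^ s) (fun i => ln (p i) + alpha).
have Z_min q : 0 <= q <= 1 -> Z q0 <= Z q.
  by move=> q01; rewrite /Z -!scaled_sum_qE q0_min.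
have [n1 _ n1P] :=
  hit_sum_ge (lam_pow_gt0 s) p_gt0 p_le1 N_gt0 q0_01 Z_min eps0.
have [n] :=
  fibre_mult_ge alpha_gt0 ell_mono ell_liminf epsa (maxn n0 (maxn n1 1)).
rewrite !geq_max => /and3P[n0n n1n n_gt0] mn; exists n => //.
rewrite -EFinB; apply: scaled_lne_ge => //; rewrite pressure_sumE.
apply: le_trans (n1P n n1n _ mn); rewrite -scaled_sum_qE mulrBr expRD.
rewrite expRM_natl lnK ?posrE ?scaled_sum_gt0// ler_wpM2l ?exprn_ge0//.
  exact/ltW/scaled_sum_gt0.
by rewrite ler_expR lerN2 mulrC ler_wpM2l.
Qed.

(** * Zeros of the pressure *)

(** Being a zero of min_q ln (scaled_sum s q) means that scaled_sum s q >= 1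
    for all q, with equality somewhere; since scaled_sum decreases in s, this
    says that s <= P_alpha q, with equality somewhere. *)
Lemma pressure_zero_min s : pressure lam p ell s = 0%E ->
  (exists2 q, 0 <= q <= 1 & P_alpha lam p alpha q = s) /\
  forall q, 0 <= q <= 1 -> s <= P_alpha lam p alpha q.
Proof.
move=> s0.
have ge1 q : 0 <= q <= 1 -> 1 <= scaled_sum s q.
  move=> q01; have := pressure_le s q01; rewrite s0 lee_fin.
  by rewrite -ler_expR expR0 lnK ?posrE ?scaled_sum_gt0.
have [q0 q0_01 [_]] := pressure_ge s.
rewrite s0 lee_fin -ler_expR expR0 lnK ?posrE ?scaled_sum_gt0// => le1.
have eq1 : scaled_sum s q0 = 1 by apply/eqP; rewrite eq_le le1 ge1.
split=> [|q q01]; last first.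
  rewrite leNgt; apply/negP => /(scaled_sum_decr q).
  by rewrite P_alphaP// ltNge ge1.
exists q0 => //; have [t [_ tU]] := P_root_exists_unique q0_01.
by rewrite -(tU s eq1) -(tU _ (P_alphaP q0_01)).
Qed.

(** The infimum of the P_alpha q is a zero. It lies below each P_alpha q, so the
    lower bound of the pressure is nonnegative there; where P_alpha q is close
    to the infimum, the Lipschitz estimate makes the upper bound close to 0. *)
Lemma pressure_zero_exists : exists2 s, 0 <= s & pressure lam p ell s = 0%E.
Proof.
pose A := [set P_alpha lam p alpha q | q in [set q | 0 <= q <= 1]].
have A0 : A !=set0.
  by exists (P_alpha lam p alpha 0), 0 => //=; rewrite lexx ler01.
have Alb : lbound A 0 by move=> _ [q q01 <-]; exact: P_alpha_ge0.
have infA : has_inf A by split => //; exists 0.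
exists (inf A); first exact: lb_le_inf.
apply/eqP; rewrite eq_le; apply/andP; split.
  apply/lee_addgt0Pr => e e0; rewrite add0e.
  have [_ [q q01 <-] qlt] := inf_adherent (divr_gt0 e0 decay_rate_gt0) infA.
  apply: (le_trans (pressure_le _ q01)); rewrite lee_fin.
  have leP : inf A <= P_alpha lam p alpha q.
    by apply: ge_inf; [exists 0|exists q].
  rewrite -ler_expR lnK ?posrE ?scaled_sum_gt0//.
  apply: (le_trans (scaled_sum_lipschitz q leP)).
  rewrite P_alphaP// mulr1 ler_expR.
  by rewrite -ler_pdivlMr ?decay_rate_gt0// lerBlDl ltW.
have [q q01 [_]] := pressure_ge (inf A).
apply: le_trans; rewrite lee_fin ln_ge0// -(P_alphaP q01).
have : inf A <= P_alpha lam p alpha q by apply: ge_inf; [exists 0|exists q].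
by rewrite le_eqVlt => /predU1P[-> //|/(scaled_sum_decr q)/ltW].
Qed.

End pressure_formula.

Theorem lemma2p4 (R : realType) (N : nat) (lam p : 'I_N -> R) (alpha : R)
    (ell : nat -> nat)
    (lam01 : forall i, 0 < lam i < 1)
    (p_gt0 : forall i, 0 < p i)
    (p_sum1 : \sum_(i < N) p i = 1)
    (alpha_gt0 : 0 < alpha)
    (ell_mono : {homo ell : a b / (a <= b)%N})
    (ell_liminf : limn_einf (fun n : nat => ((ell n)%:R / ln (n%:R : R))%:E)
                  = (alpha^-1)%:E) :
  [/\ exists! s : R, pressure_zero lam p ell s,
      forall q : R, 0 <= q <= 1 -> exists! t : R, P_root lam p alpha q t
    & ereal_inf [set (P_alpha lam p alpha q)%:E | q in `[0, 1]%classic]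
      = (s_crit lam p ell)%:E].
Proof.
have minP := pressure_zero_min lam01 p_gt0 p_sum1 alpha_gt0 ell_mono ell_liminf.
have [s s0 s_zero] :=
  pressure_zero_exists lam01 p_gt0 p_sum1 alpha_gt0 ell_mono ell_liminf.
have [[q0 q0_01 Pq0] sP] := minP s s_zero.
have s_unique s' : pressure_zero lam p ell s' -> s' = s.
  move=> [_ /minP[[q1 q1_01 <-] s'P]]; apply/eqP; rewrite eq_le sP// andbT.
  by rewrite -Pq0 s'P.
split.
- by exists s; split=> // s' s'0; rewrite (s_unique s').
- by move=> q; exact: P_root_exists_unique.
have -> : s_crit lam p ell = s by apply: xget_unique.
apply/eqP; rewrite eq_le; apply/andP; split.
  by apply: ereal_inf_lbound; exists q0; [exact: q0_01|rewrite Pq0].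
by apply: le_ereal_inf_tmp => _ [q q01 <-]; rewrite lee_fin; exact: sP q01.
Qed.
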